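(* Let $X$ be a Banach space over $\mathbb{C}$, $H$ a Hilbert space over $\mathbb{C}$, and $A:X\to H$ a (nonzero) closed linear operator with dense domain $\mathcal{D}(A)\subset X$ and closed range. Then for every $x\in\mathcal{D}(A^*A)$, $$\|Ax\|_H^2\leqslant\|x\|_X\,\|A^*Ax\|_{X^*}.$$ This inequality is sharp in the following sense: $$\sup_{x\in\mathcal{D}(A^*A),\ x\notin\ker A}\frac{\|Ax\|_H^2}{\|x\|_X\,\|A^*Ax\|_{X^*}}=1 .$$
   Context: $X^*$ is the dual space of $X$ and $A^*:H\to X^*$ is the dual (adjoint) operator of the densely defined operator $A$, with $H$ identified with its dual through the scalar product. $\mathcal{D}(A^*A)=\{x\in\mathcal{D}(A):Ax\in\mathcal{D}(A^* )\}$. *)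

(* Defs.v *)
From mathcomp Require Import all_boot all_order all_algebra sesquilinear.
From mathcomp Require Import all_classical all_reals all_analysis.
From mathcomp Require Import complex.

Set Implicit Arguments.
Unset Strict Implicit.
Unset Printing Implicit Defensive.

Import Order.TTheory GRing.Theory Num.Theory numFieldNormedType.Exports.

Local Open Scope classical_set_scope.
Local Open Scope ring_scope.
Local Open Scope complex_scope.

(* A (possibly unbounded) linear operator: op is only meaningful on the linear
   subspace dom; every notion below restricts op to dom. *)
Record operator (K : numFieldType) (X Y : normedModType K) := Operator {
  dom : set X ;
  op :> X -> Y ;
  dom0 : dom 0 ;
  dom_lin : forall (a : K) (x y : X), dom x -> dom y -> dom (a *: x + y) ;
  op_lin : forall (a : K) (x y : X), dom x -> dom y ->
    op (a *: x + y) = a *: op x + op y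
}.

Section Operator.
Context (K : numFieldType) (X Y : normedModType K).
Implicit Type A : operator X Y.

Definition graph A : set (X * Y) := [set (x, A x) | x in dom A].
Definition ran A : set Y := A @` dom A.
Definition ker A : set X := [set x | dom A x /\ A x = 0].

Definition closed_op A : Prop := closed (graph A).
Definition densely_defined A : Prop := dense (dom A).
Definition nonzero_op A : Prop := exists2 x, dom A x & A x != 0.

End Operator.

(* The dual space X^* as the set of continuous linear functionals. *)
Definition dual_space (K : numFieldType) (X : normedModType K) : set (X -> K) :=
  [set f | scalar f /\ continuous (f : X -> K^o)].
Arguments dual_space {K} X _.

Section Norms.
Context (R : realType).

(* The library norm over R[i] takes its values in the nonnegative reals of
   R[i]; rnorm is the same number as an element of R. *)
Definition rnorm (X : normedModType R[i]) (x : X) : R := complex.Re `|x|.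

(* For f in the dual the set is nonempty and bounded, so that sup is the actual
   least upper bound. *)
Definition dual_norm (X : normedModType R[i]) (f : X -> R[i]) : R :=
  sup [set complex.Re `|f x| | x in [set x : X | rnorm x <= 1]].

End Norms.

(* The norm of H is the one induced by the scalar product, which is linear in
   its first argument and conjugate-linear in the second; a Hilbert space is a
   completeNormedModType with such a scalar product. *)
Definition norm_from_dot (R : realType) (H : normedModType R[i])
    (dot : {dot H for Num.conj}) : Prop :=
  forall h : H, `|h| ^+ 2 = dot h h.

Section Adjoint.
Context (R : realType) (X H : normedModType R[i]).
Context (dot : {dot H for Num.conj}).
Implicit Type A : operator X H.

(* h in H is identified with the functional dot ^~ h, so that A^* h is the
   functional f in X^* with f x = dot (A x) h on dom A. *)
Definition adjoint_at A (h : H) : set (X -> R[i]) :=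
  [set f | dual_space X f /\ forall x, dom A x -> f x = dot (A x) h].

Definition adjoint_dom A : set H := [set h | exists f, adjoint_at A h f].

(* For densely defined A, adjoint_at A h has at most one element; adjoint A h
   is that element when h is in adjoint_dom A, and the zero functional
   (a default value) otherwise. *)
Definition adjoint A (h : H) : X -> R[i] := xget (fun=> 0) (adjoint_at A h).

Definition dom_adjoint_comp A : set X :=
  [set x | dom A x /\ adjoint_dom A (A x)].

End Adjoint.

(* Main.v *)
From HB Require Import structures.
Require Import Defs.
From mathcomp Require Import all_boot all_order all_algebra sesquilinear.
From mathcomp Require Import all_classical all_reals all_analysis.
From mathcomp Require Import complex ring lra.
Import Order.TTheory GRing.Theory Num.Theory numFieldNormedType.Exports.
Set Implicit Arguments.
Unset Strict Implicit.
Unset Printing Implicit Defensive.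
Local Open Scope classical_set_scope.
Local Open Scope ring_scope.
Local Open Scope complex_scope.

(* The inequality is [|A x|^2 = (A^* A x) x].  For sharpness, let [Q] be the
   norm of the inverse of the bijection [X / ker A -> ran A] induced by [A],
   which is finite by the open mapping theorem because [ran A] is closed.
   Choose [x0] with [d(x0, ker A)] close to [Q |A x0|] and, by Hahn-Banach, a
   functional [f] with [|f| <= d(-, ker A)] and [|f x0| >= d(x0, ker A)].  It
   vanishes on [ker A], so it is a bounded functional of [A x] and, by Riesz on
   [ran A], [f = A^* (A x')].  Here [|f| <= 1] and, by Cauchy-Schwarz at [x0],
   [|A x'|] is at least about [Q], while [x'] can be moved along [ker A] so that
   [|x'|] is at most about [Q |A x'|]; hence [x'] is nearly optimal. *)

(** * The real-valued norm and its topology *)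

Section RealNorm.
Context (R : realType).

(* Same number as rnorm, but also available on the scalars R[i]. *)
Definition nrm (V : normedZmodType R[i]) (x : V) : R := complex.Re `|x|.

Context (V : normedZmodType R[i]).
Implicit Types x y : V.

Lemma nrmE x : `|x| = (nrm x)%:C.
Proof. by rewrite RRe_real // normr_real. Qed.

Lemma nrm_ge0 x : 0 <= nrm x.
Proof. by rewrite -ler0c -nrmE. Qed.

Lemma nrm0 : nrm (0 : V) = 0.
Proof. by rewrite /nrm normr0. Qed.

Lemma nrm_eq0 x : (nrm x == 0) = (x == 0).
Proof. by rewrite -(inj_eq (@complexI R)) -nrmE normr_eq0. Qed.

Lemma nrm_gt0 x : (0 < nrm x) = (x != 0).
Proof. by rewrite lt0r nrm_eq0 nrm_ge0 andbT. Qed.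

Lemma nrmN x : nrm (- x) = nrm x.
Proof. by rewrite /nrm normrN. Qed.

Lemma nrmBC x y : nrm (x - y) = nrm (y - x).
Proof. by rewrite /nrm distrC. Qed.

Lemma nrmD x y : nrm (x + y) <= nrm x + nrm y.
Proof. by rewrite -lecR rmorphD /= -!nrmE ler_normD. Qed.

Lemma nrmB_trans z x y : nrm (x - y) <= nrm (x - z) + nrm (z - y).
Proof. by rewrite (le_trans _ (nrmD _ _)) // addrA subrK. Qed.

Lemma nrm_ltE x (e : R) : (nrm x < e) = (`|x| < e%:C).
Proof. by rewrite nrmE ltcR. Qed.

End RealNorm.

Section RealNormScale.
Context (R : realType).

Lemma nrmM (a b : R[i]) : nrm (a * b) = nrm a * nrm b.
Proof. by apply: complexI; rewrite rmorphM /= -!nrmE normrM. Qed.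

Lemma nrm_real (r : R) : nrm (r%:C) = `|r|.
Proof. by rewrite /nrm normc_def /= expr0n addr0 sqrtr_sqr. Qed.

Lemma Re_le_nrm (a : R[i]) : complex.Re a <= nrm a.
Proof. by rewrite (le_trans (ler_norm _)) // -lecR -nrmE normc_ge_Re. Qed.

Lemma nrmZ (V : normedModType R[i]) (a : R[i]) (x : V) :
  nrm (a *: x) = nrm a * nrm x.
Proof. by apply: complexI; rewrite rmorphM /= -!nrmE normrZ. Qed.

(** Comparable complex numbers have equal imaginary parts, so a positive radius in [R[i]] is a real
    one. *)
Lemma pos_complexP (e : R[i]) : 0 < e -> exists2 r : R, 0 < r & e = r%:C.
Proof.
by case: e => a b; rewrite ltcE /= => /andP[/eqP -> a0]; exists a.
Qed.

End RealNormScale.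

Section Topology.
Context (R : realType).

Lemma closed_approx (V : normedModType R[i]) (C : set V) (x : V) : closed C ->
  (forall e : R, 0 < e -> exists2 y, C y & nrm (x - y) < e) -> C x.
Proof.
move=> clC Cx; apply: clC => B /nbhs_ballP[e /= /pos_complexP[r r0 ->]] xB.
have [y Cy xy] := Cx r r0; exists y; split => //; apply: xB.
by rewrite -ball_normE /= -nrm_ltE.
Qed.

Lemma dense_approx (V : normedModType R[i]) (D : set V) (x : V) (e : R) :
  dense D -> 0 < e -> exists2 y, D y & nrm (x - y) < e.
Proof.
move=> dD e0; have e0' : 0 < e%:C by rewrite ltcR.
have [||y []] := dD (ball x e%:C).
- by exists x; exact: ballxx.
- exact: ball_open.
by rewrite -ball_normE /= -nrm_ltE => xy Dy; exists y.
Qed.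

Lemma complete_nrm (V : completeNormedModType R[i]) (u : nat -> V) :
  (forall e : R, 0 < e -> exists N, forall m n, (N <= m)%N -> (N <= n)%N ->
    nrm (u m - u n) < e) ->
  exists l, forall e : R, 0 < e -> exists N, forall n, (N <= n)%N ->
    nrm (l - u n) < e.
Proof.
move=> cu; have /cauchy_cvg : cauchy (u @ \oo).
  apply: cauchy_exP => e /pos_complexP[r r0 ->].
  have [N uN] := cu r r0; exists (u N), N => // n /= Nn.
  by rewrite -ball_normE /= -nrm_ltE uN.
move=> /cvg_ex[l ul]; exists l => e e0.
have e0' : 0 < e%:C by rewrite ltcR.
have /cvgrPdist_lt/(_ _ e0')[N _ uN] := ul.
by exists N => n /uN; rewrite /= -nrm_ltE.
Qed.

Lemma closed_op_approx (X Y : normedModType R[i]) (A : operator X Y) x y :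
  closed_op A ->
  (forall e : R, 0 < e -> exists2 z, dom A z &
     nrm (x - z) < e /\ nrm (y - A z) < e) ->
  dom A x /\ A x = y.
Proof.
move=> clA xyA; suff [z Az [<- <-]] : graph A (x, y) by [].
apply: clA => B /nbhs_ballP[e /= /pos_complexP[r r0 ->]] xyB.
have [z Az [xz yz]] := xyA r r0; exists (z, A z); split; first by exists z.
by apply: xyB; split; rewrite -ball_normE /= -nrm_ltE.
Qed.

Lemma dual_space_bounded (X : normedModType R[i]) (f : X -> R[i]) :
  dual_space X f -> exists C : R, forall x, nrm (f x) <= C * nrm x.
Proof.
move=> [sf cf].
pose F : {linear X -> R[i]^o} :=
  HB.pack (f : X -> R[i]^o) (GRing.isLinear.Build _ _ _ _ _ sf).
have /linear_bounded_continuous/linear_boundedP/pinfty_ex_gt0 : continuous F.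
  exact: cf.
move=> [M /pos_complexP[r r0 ->] FM]; exists r => x.
by rewrite -lecR rmorphM /= -!nrmE; exact: FM.
Qed.

Lemma dual_space_intro (X : normedModType R[i]) (f : X -> R[i]) (C : R) :
  scalar f -> (forall x, nrm (f x) <= C * nrm x) -> dual_space X f.
Proof.
move=> sf fC; split=> //.
pose F : {linear X -> R[i]^o} :=
  HB.pack (f : X -> R[i]^o) (GRing.isLinear.Build _ _ _ _ _ sf).
suff : continuous F by [].
apply/linear_bounded_continuous/linear_boundedP.
exists C%:C; split; first by rewrite complex_real.
move=> r Cr x; rewrite (le_trans _ (ler_wpM2r _ (ltW Cr))) //.
by rewrite !nrmE -rmorphM /= lecR; exact: fC.
Qed.

End Topology.

(** * Hahn-Banach *)

Section HahnBanachReal.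
Context (R : realType) (V : lmodType R) (p : V -> R).
Hypothesis pD : forall x y, p (x + y) <= p x + p y.
Hypothesis pZ : forall (a : R) x, 0 <= a -> p (a *: x) = a * p x.

(** A partial linear functional is represented by its graph. Single-valuedness follows from
    domination: two values at one vector differ by at most [p 0 = 0]. *)
Let dominated_subspace (G : set (V * R^o)) :=
  (forall a z w, G z -> G w -> G (a *: z + w)) /\
  (forall z, G z -> (z.2 : R) <= p z.1).

Let subspace0 G z : dominated_subspace G -> G z -> G (0, 0).
Proof.
move=> [lG _] Gz; have := lG (-1) _ _ Gz Gz.
by rewrite scaleN1r addNr.
Qed.

Let subspaceZ G a z : dominated_subspace G -> G z -> G (a *: z).
Proof.
move=> dG Gz; have := dG.1 a _ _ Gz (subspace0 dG Gz).
by rewrite -[_ *: _ + _]/(_ + 0) addr0.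
Qed.

(** An admissible value at [v] lies above every [z.2 - p (z.1 - v)] and below every
    [p (w.1 + v) - w.2]. Subadditivity separates the two families, and the supremum of the first is
    taken. *)
Let extension G v z0 : dominated_subspace G -> G z0 -> exists c : R^o,
  dominated_subspace [set w | exists t z, G z /\ w = z + t *: (v, c)].
Proof.
move=> dG Gz0; have [lG pG] := dG; have G0 := subspace0 dG Gz0.
have lu z w : G z -> G w -> z.2 - p (z.1 - v) <= p (w.1 + v) - w.2 :> R.
  move=> Gz Gw; have := pG _ (lG 1 _ _ Gz Gw); rewrite scale1r /= => h.
  have := pD (z.1 - v) (w.1 + v).
  by rewrite addrACA addNr addr0; lra.
pose E := [set (z.2 : R) - p (z.1 - v) | z in G].
have supE : has_sup E.
  split; first by exists (z0.2 - p (z0.1 - v)), z0.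
  by exists (p (z0.1 + v) - z0.2) => _ [z Gz <-]; exact: lu.
have lc z : G z -> z.2 - p (z.1 - v) <= sup E.
  by move=> Gz; apply: ub_le_sup; [exact: supE.2 | exists z].
have uc z : G z -> sup E <= p (z.1 + v) - z.2.
  by move=> Gz; apply: ge_sup; [exact: supE.1 | move=> _ [w Gw <-]; exact: lu].
exists (sup E); split.
- move=> a _ _ [t [z [Gz ->]]] [s [w [Gw ->]]].
  exists (a * t + s), (a *: z + w); split; first exact: lG.
  by rewrite scalerDr scalerDl scalerA !addrA; congr (_ + _); rewrite addrAC.
- move=> _ [t [z [Gz ->]]] /=.
  (* Dividing [z] by [|t|] reduces [t < 0] to [lc] and [t > 0] to [uc], by positive homogeneity. *)
  have [t0|t0|->] := ltgtP t 0; last by rewrite scale0r scale0r !addr0 pG.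
  + have s0 : 0 < - t by rewrite oppr_gt0.
    have -> : z = - t *: ((- t)^-1 *: z).
      by rewrite scalerA divff ?scale1r // gt_eqF.
    have := lc _ (subspaceZ (- t)^-1 dG Gz).
    move: (_ *: z) => w lcw.
    have -> : (- t *: w).1 + t *: v = - t *: (w.1 - v).
      by rewrite scalerBr -scaleNr opprK.
    rewrite (pZ _ (ltW s0)) /= -[_ *: w.2]/(- t * w.2) -[t *: _]/(t * sup E).
    have := ler_wpM2l (ltW s0) lcw; lra.
  + have -> : z = t *: (t^-1 *: z) by rewrite scalerA divff ?scale1r // gt_eqF.
    have := uc _ (subspaceZ t^-1 dG Gz).
    move: (_ *: z) => w ucw.
    rewrite /= -(scalerDr t w.1) (pZ _ (ltW t0)) -[_ *: w.2]/(t * w.2) -[t *: _]/(t * sup E).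
    have := ler_wpM2l (ltW t0) ucw; lra.
Qed.

Let dominated_line x0 :
  dominated_subspace [set z | exists t, z = t *: ((x0, p x0) : V * R^o)].
Proof.
split=> [a _ _ [t ->] [s ->]|_ [t ->] /=].
  by exists (a * t + s); rewrite scalerDl scalerA.
rewrite -[t *: _]/(t * p x0).
have [t0|t0] := leP 0 t; first by rewrite pZ.
have p0 : p 0 = 0 by rewrite -(scale0r 0) pZ // mul0r.
have := pD (t *: x0) (- t *: x0).
have s0 : 0 <= - t by rewrite oppr_ge0 ltW.
by rewrite -scalerDl subrr scale0r p0 (pZ _ s0); lra.
Qed.

Theorem hahn_banach_real (x0 : V) : exists f : V -> R,
  [/\ scalar f, forall x, f x <= p x & f x0 = p x0].
Proof.
pose z0 : V * R^o := (x0, p x0).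
(* For nonempty [G] the second clause means that [z0] is in [G]. In this form it also holds for the
   empty set, the union of the empty chain. *)
pose P (G : set (V * R^o)) :=
  dominated_subspace G /\ forall z, G z -> G (z + z0).
have [F FP totF|G [[dG Gz0] maxG]] := @Zorn_bigcup _ P.
  split; last first.
    by move=> z [G FG Gz]; exists G => //; apply: (FP G FG).2.
  split=> [a z w [G FG Gz] [H FH Hw]|z [G FG Gz]]; last exact: (FP G FG).1.2.
  have [GH|HG] := totF _ _ FG FH.
    by exists H => //; apply: (FP H FH).1.1 => //; exact: GH.
  by exists G => //; apply: (FP G FG).1.1 => //; exact: HG.
have maxG' H : G `<=` H -> P H -> H `<=` G.
  move=> GH PH; apply: contrapT => HG; exact: (maxG H).
(* A maximal [G] is nonempty, since the line through [z0] properly extends the empty set. *)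
have [z1 Gz1] : exists z, G z.
  apply: contrapT => noG.
  have PL : P [set z | exists t, z = t *: z0].
    split; first exact: dominated_line.
    by move=> _ [t ->]; exists (t + 1); rewrite scalerDl scale1r.
  have : G z0.
    apply: (maxG' _ _ PL); first by move=> z Gz; case: noG; exists z.
    by exists 1; rewrite scale1r.
  by move=> ?; apply: noG; exists z0.
have G0 := subspace0 dG Gz1.
have Gx0 : G z0 by have := Gz0 _ G0; rewrite -[(0, 0)]/(0 : V * R^o) add0r.
have totG v : exists c : R, G (v, c).
  have [c dGc] := extension v dG Gz1.
  exists c; apply: (maxG' _ _ (conj dGc _)).
  - by move=> z Gz; exists 0, z; rewrite scale0r addr0.
  - move=> _ [t [z [Gz ->]]]; exists t, (z + z0); split; first exact: Gz0.
    by rewrite addrAC.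
  - by exists 1, (0, 0); rewrite scale1r add0r.
have [f Gf] := choice totG.
have p0 : p 0 = 0 by rewrite -(scale0r 0) pZ // mul0r.
have uG v (c d : R) : G (v, c) -> G (v, d) -> c = d.
  move=> Gc Gd; have := dG.2 _ (dG.1 (-1) _ _ Gc Gd).
  have := dG.2 _ (dG.1 (-1) _ _ Gd Gc).
  rewrite /= !scaleN1r !addNr p0; lra.
exists f; split=> [a x y|x|]; [|exact: (dG.2 _ (Gf x))|exact: (uG x0)].
exact: (uG _ _ _ (Gf _) (dG.1 a _ _ (Gf x) (Gf y))).
Qed.

End HahnBanachReal.

(** An alias of [X] that carries the real module structure obtained by restriction of scalars. *)
Definition realified (R : realType) (X : lmodType R[i]) : Type := X.

Section Realified.
Context (R : realType) (X : lmodType R[i]).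

HB.instance Definition _ := GRing.Zmodule.on (realified X).

Let scale (a : R) (x : realified X) : realified X := a%:C *: (x : X).

Let scaleA a b x : scale a (scale b x) = scale (a * b) x.
Proof. by rewrite /scale scalerA rmorphM. Qed.

Let scale1 : left_id 1 scale.
Proof. by move=> x; rewrite /scale scale1r. Qed.

Let scaleDr : right_distributive scale +%R.
Proof. by move=> a x y; rewrite /scale scalerDr. Qed.

Let scaleDl x : {morph scale^~ x : a b / a + b}.
Proof. by move=> a b; rewrite /scale rmorphD scalerDl. Qed.

HB.instance Definition _ :=
  GRing.Zmodule_isLmodule.Build R (realified X) scaleA scale1 scaleDr scaleDl.

Lemma realified_scaleE (a : R) (x : realified X) : a *: x = a%:C *: (x : X).
Proof. by []. Qed.

End Realified.

Section HahnBanach.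
Context (R : realType) (X : lmodType R[i]) (p : X -> R).
Hypothesis pD : forall x y, p (x + y) <= p x + p y.
Hypothesis pZ : forall a x, p (a *: x) = nrm a * p x.

(** A complex functional is recovered from its real part [g] as [g x - i g (i x)]; the real theorem
    on [realified X] supplies [g]. *)
Theorem hahn_banach (x0 : X) : exists f : X -> R[i],
  [/\ scalar f, forall x, nrm (f x) <= p x & p x0 <= nrm (f x0)].
Proof.
have [a x a0|g [gl gp gx0]] := @hahn_banach_real R (realified X) p pD _ x0.
  by rewrite realified_scaleE pZ nrm_real ger0_norm.
have gD (x y : X) : g (x + y) = g x + g y.
  by have := gl 1 x y; rewrite scale1r mul1r.
have g0 : g 0 = 0 by have := gD 0 0; rewrite addr0; lra.
have gZ (a : R) (x : X) : g (a%:C *: x) = a * g x.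
  by have := gl a x 0; rewrite !addr0 realified_scaleE g0 addr0.
have gN (x : X) : g (- x) = - g x.
  by have := gD x (- x); rewrite subrr g0; lra.
have p_ge0 x : 0 <= p x.
  have := pD x (- 1%:C *: x); rewrite pZ nrmN nrm_real normr1 scaleNr scale1r.
  by rewrite subrr -(scale0r 0) pZ nrm0; lra.
pose f (x : X) : R[i] := g x -i* g ('i *: x).
have fD (x y : X) : f (x + y) = f x + f y.
  by rewrite /f scalerDr !gD opprD.
have fZr (a : R) (x : X) : f (a%:C *: x) = a%:C * f x.
  rewrite /f scalerA mulrC -scalerA !gZ.
  by apply/eqP; rewrite eq_complex /= !mul0r subr0 addr0 mulrN !eqxx.
have fi (x : X) : f ('i *: x) = 'i * f x.
  rewrite /f scalerA -expr2 sqr_i scaleN1r gN.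
  by apply/eqP; rewrite eq_complex /= !mul0r !mul1r sub0r add0r !opprK !eqxx.
have fZ (a : R[i]) (x : X) : f (a *: x) = a * f x.
  by rewrite [a]complexE scalerDl fD mulrDl -scalerA fi !fZr mulrA.
exists f; split=> [a x y|x|]; first by rewrite fD fZ.
- have [->|fx0] := eqVneq (f x) 0; first by rewrite nrm0.
  (* This unimodular factor makes [f (a *: x)] real, hence equal to [g (a *: x)], which
     [p (a *: x) = p x] dominates. *)
  pose a := `|f x| / f x.
  have a1 : nrm a = 1.
    by apply: complexI; rewrite -nrmE normrM normfV normr_id divff ?normr_eq0.
  have := gp (a *: x); rewrite pZ a1 mul1r; apply: le_trans.
  have : f (a *: x) = `|f x| by rewrite fZ divfK.
  by rewrite /f nrmE => -[-> _].
- rewrite -gx0; exact: (Re_le_nrm (f x0)).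
Qed.

End HahnBanach.

(** * Riesz representation *)

Section Hilbert.
Context (R : realType) (H : completeNormedModType R[i]).
Context (dot : {dot H for Num.conj}) (dot_norm : norm_from_dot dot).

Let dotE (x : H) : dot x x = (nrm x ^+ 2)%:C.
Proof. by rewrite -dot_norm nrmE rmorphXn. Qed.

Lemma parallelogram (x y : H) :
  nrm (x + y) ^+ 2 + nrm (x - y) ^+ 2 = 2 * nrm x ^+ 2 + 2 * nrm y ^+ 2.
Proof.
apply: complexI; rewrite !mulr_natl !mulr2n !rmorphD /= -!dotE dnormD dnormB.
ring.
Qed.

(** Pythagoras for the component of [x] orthogonal to [y]. It yields Cauchy-Schwarz, and the
    orthogonality of the minimizer in [riesz]. *)
Lemma nrm_sub_proj (x y : H) : y != 0 ->
  nrm (x - dot x y / dot y y *: y) ^+ 2 =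
  nrm x ^+ 2 - nrm (dot x y) ^+ 2 / nrm y ^+ 2.
Proof.
move=> y0; have yy0 : dot y y != 0 by rewrite dnorm_eq0.
have nJ : Num.conj (dot y y)^-1 = (dot y y)^-1.
  by rewrite geC0_conj // invr_ge0 dnorm_ge0.
apply: complexI; rewrite rmorphB /= (rmorphM _ (nrm (dot x y) ^+ 2)) fmorphV /=.
rewrite -!dotE rmorphXn /= -nrmE dnormB dnormZ linearZr_LR /= !normCK.
rewrite !rmorphM /= conjCK !nJ.
by field.
Qed.

Lemma cauchy_schwarz (x y : H) : nrm (dot x y) <= nrm x * nrm y.
Proof.
have [->|y0] := eqVneq y 0; first by rewrite linear0r !nrm0 mulr0.
have y0' : 0 < nrm y by rewrite nrm_gt0.
rewrite -(@ler_pXn2r _ 2) ?nnegrE ?mulr_ge0 ?nrm_ge0 //.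
rewrite exprMn -ler_pdivrMr ?exprn_gt0 // -subr_ge0 -nrm_sub_proj //.
exact: sqr_ge0.
Qed.

(** A minimizing sequence is Cauchy by the parallelogram identity, because midpoints stay in [C] and
    so have squared norm at least the infimum. *)
Lemma min_norm (C : set H) : C !=set0 ->
  (forall x, (forall e : R, 0 < e -> exists2 y, C y & nrm (x - y) < e) -> C x) ->
  (forall x y, C x -> C y -> C (2^-1 *: (x + y))) ->
  exists2 u, C u & forall c, C c -> nrm u <= nrm c.
Proof.
move=> C0 clC midC; pose E := [set nrm c ^+ 2 | c in C].
have lbE : has_inf E.
  split; first by case: C0 => c Cc; exists (nrm c ^+ 2), c.
  by exists 0 => _ [c Cc <-]; exact: sqr_ge0.
have infE c : C c -> inf E <= nrm c ^+ 2.
  by move=> Cc; apply: ge_inf; [exact: lbE.2 | exists c].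
have [u uP] : {u : nat -> H &
    forall n, C (u n) /\ nrm (u n) ^+ 2 < inf E + n.+1%:R^-1}.
  apply: (@choice _ _ (fun n c => C c /\ nrm c ^+ 2 < inf E + n.+1%:R^-1)) => n.
  have n0 : 0 < n.+1%:R^-1 :> R by [].
  by have [_ [c Cc <-] cn] := inf_adherent n0 lbE; exists c.
have du m n : nrm (u m - u n) ^+ 2 <= 2 * m.+1%:R^-1 + 2 * n.+1%:R^-1.
  have [Cm um] := uP m; have [Cn un] := uP n.
  have := infE _ (midC _ _ Cm Cn); have := parallelogram (u m) (u n).
  have -> : nrm (2^-1 *: (u m + u n)) = 2^-1 * nrm (u m + u n).
    have <- : (2^-1 : R)%:C = 2^-1 by rewrite fmorphV rmorph_nat.
    by rewrite nrmZ nrm_real ger0_norm // invr_ge0.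
  rewrite exprMn; move: (m.+1%:R^-1) (n.+1%:R^-1) um un => a b; lra.
have [|l ul] := @complete_nrm _ _ u.
  move=> e e0; have e4 : 0 < e ^+ 2 / 4 by rewrite divr_gt0 ?exprn_gt0.
  have [N _ Ne] := near_infty_natSinv_lt (PosNum e4).
  exists N => m n /Ne /= me /Ne /= ne.
  rewrite -(@ltr_pXn2r _ 2) ?nnegrE ?nrm_ge0 ?ltW // (le_lt_trans (du m n)) //.
  move: (m.+1%:R^-1) (n.+1%:R^-1) me ne => a b; lra.
have Cl : C l.
  apply: clC => e e0; have [N uN] := ul _ e0.
  by exists (u N); [exact: (uP N).1 | exact: uN].
exists l => // c Cc; apply/ler_addgt0Pr => e e0.
have e2 : 0 < e / 2 by rewrite divr_gt0.
have [N uN] := ul _ e2.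
have e4 : 0 < (e / 2) ^+ 2 by rewrite exprn_gt0.
have [N' _ uN'] := near_infty_natSinv_lt (PosNum e4).
pose n := maxn N N'.
(* After squaring: [nrm (u n) ^+ 2] is below [nrm c ^+ 2 + (e / 2) ^+ 2], and the cross term of the
   right-hand square is nonnegative. *)
have le_un : nrm (u n) <= nrm c + e / 2.
  have c0 := nrm_ge0 c.
  rewrite -(@ler_pXn2r _ 2) ?nnegrE ?nrm_ge0 ?(addr_ge0 c0 (ltW e2)) //.
  have := (uP n).2; have := infE _ Cc; have /= := uN' n (leq_maxr _ _).
  have : 0 <= nrm c * (e / 2) by rewrite mulr_ge0 // ltW.
  rewrite sqrrD; move: (n.+1%:R^-1) => a; lra.
have := uN n (leq_maxl _ _); have := nrmD (l - u n) (u n).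
rewrite subrK; lra.
Qed.

(** The functional is controlled on [M] only, where the element [u] of least norm with [g u = 1] is
    orthogonal to the kernel of [g]; the representing vector is [u] divided by [dot u u]. *)
Lemma riesz (M : set H) (g : H -> R[i]) (Q : R) : closed M -> M 0 -> 0 < Q ->
  (forall a x y, M x -> M y -> M (a *: x + y)) ->
  (forall a x y, M x -> M y -> g (a *: x + y) = a * g x + g y) ->
  (forall x, M x -> nrm (g x) <= Q * nrm x) ->
  exists2 h, M h & forall x, M x -> g x = dot x h.
Proof.
move=> clM M0 Q0 linM ling gQ.
have g0 : g 0 = 0.
  apply/eqP; rewrite -nrm_eq0 eq_le nrm_ge0 (le_trans (gQ _ M0)) //.
  by rewrite nrm0 mulr0.
have MZ a x : M x -> M (a *: x) by move=> Mx; rewrite -[_ *: _]addr0; exact: linM.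
have gZ a x : M x -> g (a *: x) = a * g x.
  by move=> Mx; rewrite -[_ *: _]addr0 ling // g0 addr0.
have MB x y : M x -> M y -> M (x - y).
  by move=> Mx My; rewrite addrC -scaleN1r; exact: linM.
have gB x y : M x -> M y -> g (x - y) = g x - g y.
  by move=> Mx My; rewrite addrC -scaleN1r ling // mulN1r addrC.
have [g_eq0|/existsNP[x1 /not_implyP[Mx1 /eqP gx1]]] :=
    pselect (forall x, M x -> g x = 0).
  by exists 0 => // x Mx; rewrite linear0r g_eq0.
pose C := [set x | M x /\ g x = 1].
have [||x y [Mx gx] [My gy]|u [Mu gu] umin] := @min_norm C.
- by exists ((g x1)^-1 *: x1); split; [exact: MZ | rewrite gZ // mulVf].
- move=> x xC; have Mx : M x.
    apply: closed_approx => // e /xC[y [My _] xy]; by exists y.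
  split=> //; apply/eqP; rewrite -subr_eq0 -nrm_eq0 eq_le nrm_ge0 andbT.
  apply/ler_addgt0Pl => e e0; rewrite addr0.
  have [y [My <-] /ltW xy] := xC (e / Q) (divr_gt0 e0 Q0).
  rewrite -gB // (le_trans (gQ _ (MB _ _ Mx My))) //.
  by rewrite mulrC -ler_pdivlMr.
- split; first by apply: MZ; rewrite -[x]scale1r; exact: linM.
  rewrite gZ; last by rewrite -[x]scale1r; exact: linM.
  by rewrite -[x]scale1r ling // gx gy mulr1 mulVf // pnatr_eq0.
have u0 : u != 0.
  by apply: contraNneq (@oner_neq0 R[i]) => u0; rewrite -gu u0 g0.
have orth w : M w -> g w = 0 -> dot w u = 0.
  move=> Mw gw; have [->|w0] := eqVneq w 0; first by rewrite linear0l.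
  suff : dot u w = 0 by move/eqP; rewrite herm_eq0C => /eqP.
  have w0' : 0 < nrm w by rewrite nrm_gt0.
  (* Removing the projection on [w] stays in [C], so by minimality it cannot shorten [u], which
     forces [dot u w = 0]. *)
  have /umin : C (u - dot u w / dot w w *: w).
    split; first by apply: MB => //; exact: MZ.
    by rewrite gB ?gZ ?gw ?mulr0 ?subr0 //; exact: MZ.
  rewrite -(@ler_pXn2r _ 2) ?nnegrE ?nrm_ge0 // nrm_sub_proj //.
  rewrite lerDl oppr_ge0 pmulr_lle0 ?invr_gt0 ?exprn_gt0 //.
  rewrite le_eqVlt ltNge sqr_ge0 orbF sqrf_eq0 nrm_eq0 => /eqP; exact.
have uu0 : dot u u != 0 by rewrite dnorm_eq0.
exists ((dot u u)^-1 *: u); first exact: MZ.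
move=> x Mx; rewrite linearZr_LR /= geC0_conj ?invr_ge0 ?dnorm_ge0 //.
have := orth (x - g x *: u) (MB _ _ Mx (MZ _ _ Mu)).
rewrite gB ?gZ ?gu ?mulr1 ?subrr //; last exact: MZ.
move=> /(_ erefl); rewrite linearBl linearZl_LR /= => /eqP.
by rewrite subr_eq0 => /eqP ->; rewrite mulrC mulfK.
Qed.

End Hilbert.

(** * Baire and the open mapping theorem *)

(** Baire category inside [M]: if no [F n] were dense in a relative ball, nested balls centred in
    [M], the one of index [n.+1] missing [F n], would shrink to a point of [M] outside every
    [F n]. *)
Lemma baire_closed (R : realType) (V : completeNormedModType R[i])
    (M : set V) (F : nat -> set V) : closed M -> M !=set0 ->
  M `<=` \bigcup_n F n ->
  exists n y (r : R), [/\ M y, 0 < r & forall z, M z -> nrm (z - y) < r ->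
    forall e : R, 0 < e -> exists2 w, F n w & nrm (z - w) < e].
Proof.
move=> clM [y0 My0] MF; apply: contrapT => nowhere.
(* A state is an index with a ball given as (centre, radius). The bound on radius plus displacement
   of the centre expresses nesting. *)
have step (s : nat * (V * R)) : exists t : V * R, M s.2.1 -> 0 < s.2.2 ->
    [/\ M t.1, 0 < t.2, t.2 + nrm (t.1 - s.2.1) <= s.2.2,
        t.2 < s.1.+1%:R^-1 & forall w, F s.1 w -> t.2 < nrm (t.1 - w)].
  case: s => n [y r] /=.
  have [My|] := pselect (M y); last by exists (y, r).
  have [r0|] := ltP 0 r; last by exists (y, r).
  have r20 : 0 < r / 2 by rewrite divr_gt0.
  have [z [Mz zy [e e0 Fe]]] : exists z, [/\ M z, nrm (z - y) < r / 2 &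
      exists2 e : R, 0 < e & forall w, F n w -> e <= nrm (z - w)].
    apply: contrapT => nz; apply: nowhere; exists n, y, (r / 2); split=> //.
    move=> z Mz zy e e0; apply: contrapT => nw; apply: nz; exists z; split=> //.
    exists e => // w Fw; rewrite leNgt; apply/negP => zw; apply: nw.
    by exists w.
  (* The three bounds give nesting, avoidance of [F n], and radii tending to 0; the last two are
     halved to make the inequalities strict. *)
  pose t := Num.min (r / 2) (Num.min (e / 2) (n.+1%:R^-1 / 2)).
  have [tr te tn] : [/\ t <= r / 2, t <= e / 2 & t <= n.+1%:R^-1 / 2].
    by rewrite /t !ge_min !lexx !orbT.
  have n0 : 0 < n.+1%:R^-1 :> R by [].
  exists (z, t); split=> //=.
  - by rewrite /t !lt_min !divr_gt0.
  - lra.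
  - move: (n.+1%:R^-1) n0 tn => a; lra.
  - move=> w /Fe; lra.
have [f fP] := choice step.
pose s := fix s n := if n is k.+1 then f (k, s k) else (y0, 1 : R).
have sM n : M (s n).1 /\ 0 < (s n).2.
  by elim: n => [|n [Mn rn]] //=; have [] := fP (n, s n) Mn rn.
have sS n : [/\ (s n.+1).2 + nrm ((s n.+1).1 - (s n).1) <= (s n).2,
    (s n.+1).2 < n.+1%:R^-1 &
    forall w, F n w -> (s n.+1).2 < nrm ((s n.+1).1 - w)].
  by have [] := fP (n, s n) (sM n).1 (sM n).2.
have nested n k : (s (k + n)%N).2 + nrm ((s (k + n)%N).1 - (s n).1) <= (s n).2.
  elim: k => [|k IH]; first by rewrite add0n subrr nrm0 addr0.
  have [+ _ _] := sS (k + n)%N.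
  have := nrmB_trans (s (k + n)%N).1 (s (k + n).+1).1 (s n).1.
  rewrite addSn; lra.
have near_s m n : (n <= m)%N -> nrm ((s m).1 - (s n).1) <= (s n).2.
  move=> nm; have := nested n (m - n)%N; rewrite subnK //.
  by have := (sM m).2; lra.
have [|l sl] := @complete_nrm _ _ (fun n => (s n).1).
  move=> e e0; have e2 : 0 < e / 2 by rewrite divr_gt0.
  have [N _ Ne] := near_infty_natSinv_lt (PosNum e2).
  exists N.+1 => m n Nm Nn; have /= := Ne N (leqnn N).
  have [_ + _] := sS N; move: (N.+1%:R^-1) => a.
  have := nrmB_trans (s N.+1).1 (s m).1 (s n).1.
  rewrite [nrm ((s N.+1).1 - _)]nrmBC.
  have := near_s _ _ Nm; have := near_s _ _ Nn; lra.
have Ml : M l.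
  apply: closed_approx => // e e0; have [N sN] := sl _ e0.
  by exists (s N).1; [exact: (sM N).1 | exact: sN].
(* The limit lies in some [F n], yet also in the closed ball of index [n.+1], which avoids [F n]. *)
have [n _ Fnl] := MF _ Ml.
have [_ _ /(_ _ Fnl)] := sS n; apply/negP; rewrite -leNgt.
apply/ler_addgt0Pr => e e0; have [N sN] := sl _ e0.
have := sN _ (leq_maxl N n.+1); have := near_s _ _ (leq_maxr N n.+1).
have := nrmB_trans (s (maxn N n.+1)).1 l (s n.+1).1.
rewrite [X in _ -> _ -> _ -> X <= _]nrmBC; lra.
Qed.

Section OperatorTheory.
Context (K : numFieldType) (X Y : normedModType K) (A : operator X Y).

Lemma op0 : A 0 = 0.
Proof.
have := op_lin 1 (dom0 A) (dom0 A); rewrite !scale1r addr0 => h.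
by apply: (@addrI _ (A 0)); rewrite -h addr0.
Qed.

Lemma domZ a x : dom A x -> dom A (a *: x).
Proof. by move=> Ax; rewrite -[_ *: _]addr0; exact: dom_lin Ax (dom0 A). Qed.

Lemma opZ a x : dom A x -> A (a *: x) = a *: A x.
Proof.
by move=> Ax; rewrite -[_ *: _ in LHS]addr0 (op_lin _ Ax (dom0 A)) op0 addr0.
Qed.

Lemma domD x y : dom A x -> dom A y -> dom A (x + y).
Proof. by move=> Ax Ay; rewrite -[x]scale1r; exact: dom_lin. Qed.

Lemma opD x y : dom A x -> dom A y -> A (x + y) = A x + A y.
Proof. by move=> Ax Ay; rewrite -[x in LHS]scale1r op_lin // scale1r. Qed.

Lemma domB x y : dom A x -> dom A y -> dom A (x - y).
Proof. by move=> Ax Ay; rewrite addrC -scaleN1r; exact: dom_lin. Qed.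

Lemma opB x y : dom A x -> dom A y -> A (x - y) = A x - A y.
Proof. by move=> Ax Ay; rewrite addrC -scaleN1r op_lin // scaleN1r addrC. Qed.

Lemma ran_lin a x y : ran A x -> ran A y -> ran A (a *: x + y).
Proof.
move=> [u Au <-] [v Av <-]; exists (a *: u + v); first exact: dom_lin.
exact: op_lin.
Qed.

End OperatorTheory.

Section OpenMapping.
Context (R : realType) (X H : completeNormedModType R[i]) (A : operator X H).
Hypotheses (clA : closed_op A) (clran : closed (ran A)).

(** Baire applied to the images of the balls of radius [n] gives a ball of [ran A] around some [y].
    Subtracting approximations of [y + h] and [y] recentres it at 0, whence the bound [n + n]. *)
Let approx_small : exists C r : R, [/\ 0 <= C, 0 < r &
  forall h, ran A h -> nrm h < r -> forall e : R, 0 < e ->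
    exists2 x, dom A x & nrm x <= C /\ nrm (h - A x) < e].
Proof.
pose F (n : nat) := A @` [set x | dom A x /\ nrm x <= n%:R].
have [||n [y [r [ry r0 nry]]]] := @baire_closed R H (ran A) F clran.
- by exists 0, 0; [exact: dom0 | exact: op0].
- move=> _ [x Ax <-]; exists (Num.truncn (nrm x)).+1 => //; exists x => //.
  by split=> //; rewrite ltW // truncnS_gt.
exists (n%:R + n%:R), r; split=> //.
move=> h rh hr e e0; have e2 : 0 < e / 2 by rewrite divr_gt0.
have ryh : ran A (y + h) by rewrite -[y]scale1r; exact: ran_lin.
have [|_ [x1 [Ax1 x1n] <-] x1e] := nry _ ryh _ _ e2; first by rewrite addrC addKr.
have [|_ [x2 [Ax2 x2n] <-] x2e] := nry _ ry _ _ e2; first by rewrite subrr nrm0.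
exists (x1 - x2); first exact: domB.
split; first by have := nrmD x1 (- x2); rewrite nrmN; lra.
have := nrmD (y + h - A x1) (- (y - A x2)); rewrite nrmN opB //.
have -> : y + h - A x1 - (y - A x2) = h - (A x1 - A x2).
  by rewrite -(addrA y) (addrC y) addrKA opprD !opprK addrA.
lra.
Qed.

(** By homogeneity: [h] is rescaled to norm [r / 2], and [approx_small] is used with tolerance
    [r / 4]. *)
Let approx_half : exists2 C : R, 0 <= C & forall h, ran A h ->
  exists2 x, dom A x & nrm x <= C * nrm h /\ nrm (h - A x) <= nrm h / 2.
Proof.
have [C [r [C0 r0 CP]]] := approx_small.
have r2 : 0 < r / 2 by rewrite divr_gt0.
exists (C / (r / 2)); first by rewrite divr_ge0 // ltW.
move=> h rh; have [->|h0] := eqVneq h 0.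
  by exists 0; [exact: dom0 | rewrite op0 subrr !nrm0 mulr0 mul0r].
have nh0 : 0 < nrm h by rewrite nrm_gt0.
pose t := r / 2 / nrm h; have t0 : 0 < t by rewrite divr_gt0.
have tC : t%:C != 0 by rewrite (inj_eq (@complexI R) _ 0) gt_eqF.
have nt (V : normedModType R[i]) (v : V) : nrm (t%:C *: v) = t * nrm v.
  by rewrite nrmZ nrm_real gtr0_norm.
have th : t * nrm h = r / 2 by rewrite divfK // gt_eqF.
have rth : ran A (t%:C *: h).
  by rewrite -[_ *: _]addr0; apply: ran_lin => //; exists 0; [exact: dom0|exact: op0].
have [||x Ax [xC xr]] := CP _ rth _ (r / 2 / 2).
- by rewrite nt th; lra.
- by rewrite divr_gt0.
exists (t%:C^-1 *: x); first exact: domZ.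
have xE : x = t%:C *: (t%:C^-1 *: x) by rewrite scalerA divff // scale1r.
split.
  rewrite -(ler_pM2l t0) -nt -xE mulrCA th divfK // gt_eqF //.
rewrite -(ler_pM2l t0) -nt scalerBr -opZ; last exact: domZ.
by rewrite -xE mulrA th ltW.
Qed.

(** Successive approximation: each correction halves the residual, the corrections are summed using
    completeness of [X], and closedness of [A] identifies the image of the sum. *)
Theorem open_mapping : exists2 C : R, 0 < C & forall h, ran A h ->
  exists2 x, dom A x & A x = h /\ nrm x <= C * nrm h.
Proof.
have [C C0 CP] := approx_half.
have step (h : H) : exists x, ran A h ->
    [/\ dom A x, nrm x <= C * nrm h & nrm (h - A x) <= nrm h / 2].
  have [rh|nrh] := pselect (ran A h); last by exists 0.
  by have [x Ax [xC xh]] := CP _ rh; exists x.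
have [f fP] := choice step.
(* The geometric series gives [2 * C]; the added 1 keeps the constant positive when [C = 0]. *)
exists (2 * C + 1); first by lra.
(* The pair (partial sum, residual). *)
move=> h rh; pose u := fix u n : X * H :=
  if n is k.+1 then let s := u k in (s.1 + f s.2, s.2 - A (f s.2)) else (0, h).
have uP n : [/\ dom A (u n).1, ran A (u n).2, A (u n).1 = h - (u n).2 &
    nrm (u n).2 <= nrm h / 2 ^+ n].
  elim: n => [|n [An rn En hn]] /=.
    by split=> //; [exact: dom0 | rewrite op0 subrr | rewrite expr0 divr1].
  have [Af fn hfn] := fP _ rn; split.
  - exact: domD.
  - by rewrite addrC -scaleN1r; apply: ran_lin => //; exists (f (u n).2).
  - by rewrite opD // En opprD opprK addrA.
  - by rewrite exprS invfM [2^-1 * _]mulrC mulrA; lra.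
have uS n : nrm ((u n.+1).1 - (u n).1) <= C * (nrm h / 2 ^+ n).
  have [_ rn _ hn] := uP n; have [_ fn _] := fP _ rn.
  by rewrite /= addrC addKr (le_trans fn) // ler_wpM2l.
(* The exact geometric sum, with its subtracted tail, lets the induction on [k] close. *)
have du n k : nrm ((u (k + n)%N).1 - (u n).1) <=
    2 * C * (nrm h / 2 ^+ n) - 2 * C * (nrm h / 2 ^+ (k + n)).
  elim: k => [|k IH]; first by rewrite add0n !subrr nrm0.
  have := nrmB_trans (u (k + n)%N).1 (u (k + n).+1).1 (u n).1.
  have := uS (k + n)%N; rewrite addSn exprS invfM.
  move: IH; move: (2 ^+ n)^-1 (2 ^+ (k + n))^-1 => a b; lra.
have du' m n : (n <= m)%N ->
    nrm ((u m).1 - (u n).1) <= 2 * C * (nrm h / 2 ^+ n).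
  move=> nm; have := du n (m - n)%N; rewrite subnK //.
  have : 0 <= 2 * C * (nrm h / 2 ^+ m).
    by rewrite !mulr_ge0 ?nrm_ge0 ?invr_ge0 ?exprn_ge0.
  lra.
have small (D e : R) : 0 <= D -> 0 < e ->
    exists N, forall n, (N <= n)%N -> D * (nrm h / 2 ^+ n) < e.
  move=> D0 e0; pose B := D * nrm h; have B0 : 0 <= B by rewrite mulr_ge0 ?nrm_ge0.
  have B1 : 0 < B + 1 by lra.
  have [N _ Ne] := near_infty_natSinv_lt (PosNum (divr_gt0 e0 B1)).
  exists N => n /Ne /=; rewrite ltr_pdivlMr // => ne; rewrite mulrA -/B.
  have n2 : (2 ^+ n)^-1 <= n.+1%:R^-1 :> R.
    by rewrite lef_pV2 ?posrE ?exprn_gt0 // -natrX ler_nat ltn_expl.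
  have n0 : 0 < n.+1%:R^-1 :> R by [].
  have := ler_wpM2l B0 n2; move: (2 ^+ n)^-1 (n.+1%:R^-1) n0 ne => a b; lra.
have [|x ux] := @complete_nrm _ _ (fun n => (u n).1).
  move=> e e0; have [|N uN] := small (4 * C) e _ e0; first by lra.
  exists N => m n Nm Nn.
  have := nrmB_trans (u N).1 (u m).1 (u n).1.
  rewrite [nrm ((u N).1 - _)]nrmBC.
  have := du' _ _ Nm; have := du' _ _ Nn; have := uN N (leqnn N).
  move: (2 ^+ N)^-1 => a; lra.
have [Ax Axh] : dom A x /\ A x = h.
  apply: closed_op_approx => // e e0.
  have [N uN] := ux _ e0; have [//|N' uN'] := small 1 e _ e0.
  have [An _ En hn] := uP (maxn N N').
  exists (u (maxn N N')).1 => //; split; first by apply: uN; exact: leq_maxl.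
  rewrite En opprB addrC subrK (le_lt_trans hn) //.
  by have := uN' _ (leq_maxr N N'); rewrite mul1r.
exists x => //; split=> //; apply/ler_addgt0Pr => e e0.
have [N uN] := ux _ e0; have := uN N (leqnn N).
have := nrmD (x - (u N).1) (u N).1; rewrite subrK.
have := du' N 0%N (leq0n _); rewrite subr0 expr0 divr1.
have := nrm_ge0 h; lra.
Qed.

End OpenMapping.

(** * Dual norm, adjoint and distance to the kernel *)

Section DualNorm.
Context (R : realType) (X : normedModType R[i]) (f : X -> R[i]).

Lemma dual_norm_bound (x : X) :
  dual_space X f -> nrm (f x) <= nrm x * dual_norm f.
Proof.
move=> df; have [C fC] := dual_space_bounded df.
have fZ a y : f (a *: y) = a * f y.
  have [sf _] := df; have f0 : f 0 = 0.
    by have := sf (-1) 0 0; rewrite scaler0 addr0 mulN1r addNr.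
  by have := sf a y 0; rewrite !addr0 f0 addr0.
have [->|x0] := eqVneq x 0.
  by rewrite -(scale0r 0) fZ mul0r nrmZ !nrm0 !mul0r.
have nx0 : 0 < nrm x by rewrite nrm_gt0.
have nV : nrm ((nrm x)^-1%:C : R[i]) = (nrm x)^-1.
  by rewrite nrm_real ger0_norm // invr_ge0 ltW.
rewrite mulrC -ler_pdivrMr // mulrC.
have -> : (nrm x)^-1 * nrm (f x) = nrm (f ((nrm x)^-1%:C *: x)).
  by rewrite fZ nrmM nV.
apply: ub_le_sup.
  exists `|C| => _ [y y1 <-]; rewrite (le_trans (fC y)) //.
  rewrite (le_trans (ler_norm _)) // normrM ler_piMr //.
  by rewrite ger0_norm // nrm_ge0.
exists ((nrm x)^-1%:C *: x) => //=.
by rewrite /rnorm -/(nrm _) nrmZ nV mulVf // gt_eqF.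
Qed.

Lemma dual_norm_le1 : (forall x, nrm (f x) <= nrm x) -> dual_norm f <= 1.
Proof.
move=> f1; apply: ge_sup.
  by exists (nrm (f 0)), 0; rewrite //= /rnorm normr0.
by move=> _ [x x1 <-]; exact: le_trans (f1 x) x1.
Qed.

End DualNorm.

Section Adjoint.
Context (R : realType) (X H : normedModType R[i]) (dot : {dot H for Num.conj}).
Context (A : operator X H).

Lemma adjoint_atP h : adjoint_dom dot A h -> adjoint_at dot A h (adjoint dot A h).
Proof. exact: xgetPex. Qed.

(** Continuous functionals that agree on a dense set coincide, so the choice made by [xget] is
    forced. *)
Lemma adjoint_unique h f :
  densely_defined A -> adjoint_at dot A h f -> adjoint dot A h = f.
Proof.
move=> dA hf; apply: xget_unique => // g hg; apply/funext => x.
have [[df fE] [dg gE]] := (hf, hg).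
have [C fC] := dual_space_bounded df; have [D gD] := dual_space_bounded dg.
have fB (k : X -> R[i]) y : dual_space X k -> k (x - y) = k x - k y.
  by move=> [sk _]; rewrite addrC -scaleN1r sk mulN1r addrC.
apply/eqP; rewrite -subr_eq0 -nrm_eq0 eq_le nrm_ge0 andbT.
apply/ler_addgt0Pl => e e0; rewrite addr0.
pose K := `|C| + `|D| + 1; have K0 : 0 < K by rewrite ltr_wpDl // addr_ge0.
have [y Ay] := dense_approx x dA (divr_gt0 e0 K0).
rewrite ltr_pdivlMr // => xy.
have -> : g x - f x = g (x - y) - f (x - y).
  by rewrite (fB g y dg) (fB f y df) (gE y Ay) (fE y Ay) opprB addrA subrK.
have := nrmD (g (x - y)) (- f (x - y)); rewrite nrmN.
have := fC (x - y); have := gD (x - y); have n0 := nrm_ge0 (x - y).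
have := ler_wpM2r n0 (ler_norm C); have := ler_wpM2r n0 (ler_norm D).
move: xy; rewrite /K; lra.
Qed.

End Adjoint.

Section KernelDistance.
Context (R : realType) (X H : normedModType R[i]) (A : operator X H).

(** The distance to [ker A], that is, the quotient seminorm of [X / ker A]; the sign of [k] is
    immaterial in a subspace. *)
Definition ker_dist (x : X) : R := inf [set nrm (x + k) | k in ker A].

Lemma ker0 : ker A 0.
Proof. by split; [exact: dom0 | exact: op0]. Qed.

Let has_inf_ker_dist x : has_inf [set nrm (x + k) | k in ker A].
Proof.
split; first by exists (nrm (x + 0)), 0 => //; exact: ker0.
by exists 0 => _ [k _ <-]; exact: nrm_ge0.
Qed.

Lemma ker_dist_le x k : ker A k -> ker_dist x <= nrm (x + k).
Proof. by move=> Ak; apply: ge_inf; [exact: (has_inf_ker_dist x).2|exists k]. Qed.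

Lemma ker_dist_le_nrm x : ker_dist x <= nrm x.
Proof. by have := ker_dist_le x ker0; rewrite addr0. Qed.

Lemma ker_dist_adherent x (e : R) : 0 < e ->
  exists2 k, ker A k & nrm (x + k) < ker_dist x + e.
Proof.
by move=> e0; have [_ [k Ak <-] ke] := inf_adherent e0 (has_inf_ker_dist x); exists k.
Qed.

Lemma ker_dist_ge0 x : 0 <= ker_dist x.
Proof.
apply: lb_le_inf; first exact: (has_inf_ker_dist x).1.
by move=> _ [k _ <-]; exact: nrm_ge0.
Qed.

Lemma ker_lin a x y : ker A x -> ker A y -> ker A (a *: x + y).
Proof.
move=> [Ax x0] [Ay y0]; split; first exact: dom_lin.
by rewrite op_lin // x0 y0 scaler0 addr0.
Qed.

Lemma ker_distD x y : ker_dist (x + y) <= ker_dist x + ker_dist y.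
Proof.
apply/ler_addgt0Pr => e e0; have e2 : 0 < e / 2 by rewrite divr_gt0.
have [k Ak ke] := ker_dist_adherent x e2.
have [l Al le] := ker_dist_adherent y e2.
have := ker_dist_le (x + y) (ker_lin 1 Ak Al); rewrite scale1r addrACA.
have := nrmD (x + k) (y + l); lra.
Qed.

Let ker_distZ_le a x : ker_dist (a *: x) <= nrm a * ker_dist x.
Proof.
(* Dividing by [nrm a + 1] covers [a = 0] as well. *)
apply/ler_addgt0Pr => e e0; have a1 : 0 < nrm a + 1 by have := nrm_ge0 a; lra.
have [k Ak] := ker_dist_adherent x (divr_gt0 e0 a1).
have := ker_dist_le (a *: x) (ker_lin a Ak ker0).
rewrite addr0 -scalerDr nrmZ => h /ltW.
move=> /(ler_wpM2l (nrm_ge0 a)); rewrite mulrDr => h'.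
rewrite (le_trans h) // (le_trans h') // lerD2l mulrCA ler_piMr ?(ltW e0) //.
by rewrite ler_pdivrMr //; lra.
Qed.

Lemma ker_distZ a x : ker_dist (a *: x) = nrm a * ker_dist x.
Proof.
apply/eqP; rewrite eq_le ker_distZ_le /=.
have [->|a0] := eqVneq a 0; first by rewrite nrm0 mul0r ker_dist_ge0.
have na0 : 0 < nrm a by rewrite nrm_gt0.
have := ker_distZ_le a^-1 (a *: x); rewrite scalerA mulVf // scale1r.
have -> : nrm a^-1 = (nrm a)^-1.
  by apply: complexI; rewrite fmorphV /= -!nrmE normfV.
by rewrite mulrC ler_pdivlMr // mulrC.
Qed.

Lemma ker_dist_ker x : ker A x -> ker_dist x = 0.
Proof.
move=> Ax; apply/eqP; rewrite eq_le ker_dist_ge0 andbT.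
have := ker_dist_le x (ker_lin (-1) Ax ker0).
by rewrite scaleN1r addr0 subrr nrm0.
Qed.

Lemma ker_dist_eq x y : dom A x -> dom A y -> A x = A y ->
  ker_dist x = ker_dist y.
Proof.
have le u v : dom A u -> dom A v -> A u = A v -> ker_dist u <= ker_dist v.
  move=> Au Av uv; have kuv : ker A (u - v).
    by split; [exact: domB | rewrite opB // uv subrr].
  by have := ker_distD v (u - v); rewrite (ker_dist_ker kuv) addr0 addrC subrK.
by move=> Ax Ay xy; apply/eqP; rewrite eq_le !le.
Qed.

(** At distance 0, some points [x + k] tend to 0 while their image stays [A x]; the closed graph
    then gives [A x = A 0 = 0]. *)
Lemma ker_dist_gt0 x : closed_op A -> dom A x -> A x != 0 -> 0 < ker_dist x.
Proof.
move=> clA Ax Ax0; rewrite lt0r ker_dist_ge0 andbT.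
apply: contra_neq Ax0 => dx0.
have [_ <-] : dom A 0 /\ A 0 = A x; last exact: op0.
apply: closed_op_approx => // e /(ker_dist_adherent x)[k [Ak k0]].
rewrite dx0 add0r => ke; exists (x + k); first exact: domD.
rewrite sub0r nrmN opD // k0 addr0 subrr nrm0; split=> //.
exact: le_lt_trans (nrm_ge0 _) ke.
Qed.

End KernelDistance.

(** * Interpolation inequality *)

Section Interpolation.
Context (R : realType) (X H : completeNormedModType R[i]).
Context (dot : {dot H for Num.conj}) (dot_norm : norm_from_dot dot).
Context (A : operator X H).

Lemma nrm_op_sqr_le x : dom_adjoint_comp dot A x ->
  nrm (A x) ^+ 2 <= nrm x * dual_norm (adjoint dot A (A x)).
Proof.
move=> [Ax /adjoint_atP[dA AE]].
rewrite (le_trans _ (dual_norm_bound x dA)) // AE // -dot_norm nrmE -rmorphXn.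
by rewrite nrm_real ler_norm.
Qed.

Hypotheses (A_nonzero : nonzero_op A) (A_closed : closed_op A).
Hypotheses (A_dense : densely_defined A) (A_ran : closed (ran A)).

(* [Q] is the norm of the inverse of [X / ker A -> ran A]. *)
Lemma inverse_norm : exists Q : R, [/\ 0 < Q,
  forall x, dom A x -> ker_dist A x <= Q * nrm (A x) &
  forall e, 0 < e -> exists x, [/\ dom A x, A x != 0 &
    (1 - e) * Q * nrm (A x) <= ker_dist A x]].
Proof.
have [C C0 CP] := open_mapping A_closed A_ran.
have [x1 Ax1 Ax10] := A_nonzero.
pose E := [set ker_dist A x / nrm (A x) | x in [set x | dom A x /\ A x != 0]].
have supE : has_sup E.
  split; first by exists (ker_dist A x1 / nrm (A x1)), x1.
  (* The preimage of [A x] from the open mapping theorem has the same distance to the kernel as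
     [x]. *)
  exists C => _ [x [Ax Ax0] <-]; rewrite ler_pdivrMr ?nrm_gt0 //.
  have [y Ay [yx yC]] := CP (A x) (ex_intro2 _ _ x Ax erefl).
  by rewrite -(ker_dist_eq Ay Ax yx) (le_trans (ker_dist_le_nrm A y)).
have QE x : dom A x -> A x != 0 -> ker_dist A x / nrm (A x) <= sup E.
  by move=> Ax Ax0; apply: ub_le_sup; [exact: supE.2 | exists x].
have Q0 : 0 < sup E.
  by rewrite (lt_le_trans _ (QE _ Ax1 Ax10)) // divr_gt0 ?nrm_gt0 ?ker_dist_gt0.
exists (sup E); split=> // [x Ax|e e0].
  have [Ax0|Ax0] := eqVneq (A x) 0; last by rewrite -ler_pdivrMr ?nrm_gt0 // QE.
  by rewrite ker_dist_ker // mulr_ge0 ?nrm_ge0 // ltW.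
have [_ [x [Ax Ax0] <-]] := sup_adherent (mulr_gt0 e0 Q0) supE.
rewrite ltr_pdivlMr ?nrm_gt0 // => /ltW; exists x; split=> //.
by rewrite mulrBl mul1r.
Qed.

(** The bound makes [f] depend only on [A x], so composing [f] with a section [s] of [A] gives a
    bounded linear functional on [ran A]; its Riesz vector lies in [ran A], hence is some [A x]. *)
Lemma functional_in_adjoint_ran (f : X -> R[i]) (Q : R) : 0 < Q -> scalar f ->
  (forall x, dom A x -> nrm (f x) <= Q * nrm (A x)) ->
  exists2 x, dom A x & forall y, dom A y -> f y = dot (A y) (A x).
Proof.
move=> Q0 sf fQ.
have [s sP] : {s : H -> X & forall h, ran A h -> dom A (s h) /\ A (s h) = h}.
  apply: (@choice _ _ (fun h x => ran A h -> dom A x /\ A x = h)) => h.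
  have [[x Ax <-]|nrh] := pselect (ran A h); first by exists x.
  by exists 0.
have rA x : dom A x -> ran A (A x) by exists x.
have fsA x : dom A x -> f (s (A x)) = f x.
  move=> Ax; have [As sE] := sP _ (rA _ Ax).
  apply/eqP; rewrite -subr_eq0 -nrm_eq0 eq_le nrm_ge0 andbT.
  have -> : f (s (A x)) - f x = f (s (A x) - x).
    have := sf (-1) x (s (A x)); rewrite scaleN1r mulN1r [- x + _]addrC => ->.
    by rewrite addrC.
  by rewrite (le_trans (fQ _ (domB As Ax))) // opB // sE subrr nrm0 mulr0.
have [|||_ [x Ax <-] fE] :=
    riesz dot_norm (g := f \o s) A_ran _ Q0 (@ran_lin _ _ _ A).
- by exists 0; [exact: dom0 | exact: op0].
- move=> a _ _ [x Ax <-] [y Ay <-] /=.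
  by rewrite -op_lin // !fsA //; [exact: sf | exact: dom_lin].
- by move=> _ [x Ax <-] /=; rewrite fsA // fQ.
by exists x => // y Ay; rewrite -fE /= ?fsA //; exact: rA.
Qed.

Lemma nearly_optimal (e : R) : 0 < e -> e < 1 -> exists x,
  [/\ dom_adjoint_comp dot A x, A x != 0 &
      (1 - e) * (nrm x * dual_norm (adjoint dot A (A x))) <= nrm (A x) ^+ 2].
Proof.
move=> e0 e1; have [Q [Q0 leQ Qadh]] := inverse_norm.
(* Half of [e] is spent on the lower bound for [A x'] and half on the upper bound for [x' + k]; they
   combine through [(1 - e) * (1 + e / 2) <= 1 - e / 2]. *)
have d0 : 0 < e / 2 by rewrite divr_gt0.
have [x0 [Ax0 nAx0 x0Q]] := Qadh _ d0.
have [f [sf fle fx0]] :=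
  hahn_banach (@ker_distD _ _ _ A) (@ker_distZ _ _ _ A) x0.
have f1 y : nrm (f y) <= nrm y := le_trans (fle y) (ker_dist_le_nrm A y).
have [|x' Ax' fE] := functional_in_adjoint_ran Q0 sf.
  by move=> y Ay; exact: le_trans (fle y) (leQ _ Ay).
have Q_le : (1 - e / 2) * Q <= nrm (A x').
  have nA0 : 0 < nrm (A x0) by rewrite nrm_gt0.
  rewrite -(ler_pM2r nA0) (le_trans x0Q) // (le_trans fx0) // fE // mulrC.
  exact: cauchy_schwarz.
have Ax'0 : 0 < nrm (A x') by apply: lt_le_trans Q_le; rewrite mulr_gt0 //; lra.
(* The tolerance is proportional to [Q * nrm (A x')], so that it becomes the factor [1 + e / 2] in
   [xkQ]. *)
have [k [Ak k0] xk] := ker_dist_adherent A x' (mulr_gt0 d0 (mulr_gt0 Q0 Ax'0)).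
exists (x' + k); have Axk : A (x' + k) = A x' by rewrite opD // k0 addr0.
have hf : adjoint_at dot A (A x') f.
  split; last exact: fE.
  by apply: (@dual_space_intro _ _ _ 1) => // y; rewrite mul1r.
split; first by split; [exact: domD | rewrite Axk; exists f].
  by rewrite Axk -nrm_gt0.
rewrite Axk (adjoint_unique A_dense hf).
have xkQ : nrm (x' + k) <= (1 + e / 2) * Q * nrm (A x').
  by rewrite (le_trans (ltW xk)) //; have := leQ _ Ax'; lra.
have : nrm (x' + k) * dual_norm f <= nrm (x' + k).
  by rewrite ler_piMr ?nrm_ge0 // dual_norm_le1.
have e1' : 0 <= 1 - e by rewrite subr_ge0 ltW.
move=> /(ler_wpM2l e1') h; rewrite (le_trans h) //.
rewrite (le_trans (ler_wpM2l e1' xkQ)) // expr2 mulrA ler_wpM2r ?nrm_ge0 //.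
apply: le_trans Q_le; rewrite mulrA ler_wpM2r ?ltW //.
have := mulr_gt0 d0 d0; lra.
Qed.

End Interpolation.

Theorem theorem18 (R : realType) (X H : completeNormedModType R[i])
    (dot : {dot H for Num.conj}) (dot_norm : norm_from_dot dot)
    (A : operator X H) (A_nonzero : nonzero_op A) (A_closed : closed_op A)
    (A_dense : densely_defined A) (A_ran : closed (ran A)) :
  (forall x : X, dom_adjoint_comp dot A x ->
     rnorm (A x) ^+ 2 <= rnorm x * dual_norm (adjoint dot A (A x))) /\
  sup [set rnorm (A x) ^+ 2 / (rnorm x * dual_norm (adjoint dot A (A x)))
      | x in dom_adjoint_comp dot A `\` ker A] = 1.
Proof.
have ineq := nrm_op_sqr_le dot_norm (A := A); split=> //.
set E := [set _ | _ in _].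
(* The inequality itself shows that the denominators are nonzero, so the quotients are genuine. *)
have prod_gt0 x : dom_adjoint_comp dot A x -> A x != 0 ->
    0 < nrm x * dual_norm (adjoint dot A (A x)).
  by move=> Dx Ax0; rewrite (lt_le_trans _ (ineq _ Dx)) // exprn_gt0 ?nrm_gt0.
have nearly := nearly_optimal dot_norm A_nonzero A_closed A_dense A_ran.
have ubE : ubound E 1.
  move=> _ [x [Dx kx] <-]; have Ax0 : A x != 0.
    by apply/eqP => Ax0; apply: kx; split=> //; exact: Dx.1.
  by rewrite ler_pdivrMr ?prod_gt0 // mul1r ineq.
have lbE e : 0 < e -> e < 1 -> 1 - e <= sup E.
  move=> e0 e1.
  have [x [Dx Ax0 xe]] := nearly _ e0 e1.
  apply: (@le_trans _ _
      (nrm (A x) ^+ 2 / (nrm x * dual_norm (adjoint dot A (A x))))).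
    by rewrite ler_pdivlMr ?prod_gt0.
  apply: ub_le_sup; first by exists 1.
  by exists x => //; split=> // -[_ Ax0']; rewrite Ax0' eqxx in Ax0.
apply/eqP; rewrite eq_le; apply/andP; split.
  apply: ge_sup => //.
  (* Any near-optimal vector witnesses that [E] is nonempty. *)
  have [||x [Dx Ax0 _]] := nearly 2^-1; [lra | lra |].
  eexists; exists x; last by [].
  by split=> // -[_ Ax0']; rewrite Ax0' eqxx in Ax0.
apply/ler_addgt0Pr => e e0; have [e1|e1] := ltP e 1.
  by have := lbE _ e0 e1; lra.
(* For [e >= 1] the bound at one half already suffices. *)
have : 1 - 2^-1 <= sup E by apply: lbE; lra.
lra.
Qed.
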